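(* For every integer $n\ge 0$, $c_9(n)$ is odd if $n=(5j^2+j)/2$ for some $j\in\mathbb{Z}$, and $c_9(n)$ is even otherwise.
   Context: A partition of $n\ge 0$ is a finite multiset of positive integers summing to $n$; the empty partition is the partition of $0$. For $n\ge 0$, $c_9(n)$ denotes the number of partitions $\lambda$ of $n$ such that either (a) all parts of $\lambda$ are distinct and greater than $1$, or (b) there is an integer $j\ge 2$ such that the part $1$ appears exactly $j^2$ times and every other part of $\lambda$ is at least $j+1$ and appears at most once. *)

(* Defs.v *)
From mathcomp Require Import all_boot.
From mathcomp Require Import ssrint.
Set Implicit Arguments. Unset Strict Implicit. Unset Printing Implicit Defensive.

(* A partition of n is encoded by its multiplicity function:
   m i = number of times the part i occurs, for 1 <= i <= n.
   (Index 0 is required to have multiplicity 0; multiplicities are < n+1,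
   which is no restriction since parts are positive and sum to n.) *)
Definition is_partition (n : nat) (m : {ffun 'I_n.+1 -> 'I_n.+1}) : bool :=
  (m ord0 == 0 :> nat) && (\sum_(i < n.+1) i * m i == n).

Definition cond_a (n : nat) (m : {ffun 'I_n.+1 -> 'I_n.+1}) : bool :=
  [forall i : 'I_n.+1, (m i <= 1) && ((i == 1 :> nat) ==> (m i == 0 :> nat))].

Definition cond_b (n : nat) (m : {ffun 'I_n.+1 -> 'I_n.+1}) : bool :=
  [exists j : 'I_n.+1, (2 <= j) &&
     [forall i : 'I_n.+1,
        if i == 1 :> nat then m i == j ^ 2 :> nat
        else (0 < m i) ==> ((j.+1 <= i) && (m i <= 1))]].

Definition c9 (n : nat) : nat :=
  #|[set m : {ffun 'I_n.+1 -> 'I_n.+1} | is_partition m && (cond_a m || cond_b m)]|.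

(* Main.v *)
(* Splitting the partitions by the number of ones gives the generating function
     (-q^2;q)_oo + sum_(j >= 2) q^(j^2) (-q^(j+1);q)_oo.
   Modulo 2 signs are irrelevant and the first term absorbs j = 0 and j = 1, so
   this is sum_(j >= 0) q^(j^2) (q^(j+1);q)_oo = (q;q)_oo sum_j q^(j^2) / (q;q)_j.
   The first Rogers-Ramanujan identity turns it into
   sum_(j in Z) (-1)^j q^(j(5j+1)/2).  That identity comes from two steps of the
   Bailey chain, started at the unit Bailey pair, in a form finite in N whose
   error terms vanish modulo q^(N+1). *)

Require Import Defs.
From mathcomp Require Import all_boot all_order all_algebra.
From mathcomp Require Import zify ring.
Import GRing.Theory Num.Theory.
Set Implicit Arguments. Unset Strict Implicit. Unset Printing Implicit Defensive.
Local Open Scope ring_scope.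

(** * Gaussian binomials and finite q-products *)

(** Gaussian binomials by the q-Pascal rule. Truncation in [n' - k'] is harmless: the other factor
    vanishes when [k' > n']. *)
Fixpoint qbin (R : comNzRingType) (q : R) (n k : nat) : R :=
  match n, k with
  | _, 0 => 1
  | 0, _.+1 => 0
  | n'.+1, k'.+1 => qbin q n' k'.+1 + q ^+ (n' - k') * qbin q n' k'
  end.

Definition qpoch (R : comNzRingType) (q : R) (n : nat) : R :=
  \prod_(0 <= i < n) (1 - q ^+ i.+1).

(** For [a <= b] this is the quotient of [qpoch q b] by [qpoch q a], written without division so
    that it makes sense for polynomials. *)
Definition qprod (R : comNzRingType) (q : R) (a b : nat) : R :=
  \prod_(a <= i < b) (1 - q ^+ i.+1).

(* The terms of index [r] and [-r] of the bilateral unit Bailey pair, added. *)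
Definition unit_alpha (R : comNzRingType) (q : R) (r : nat) : R :=
  if r == 0%N then 1 else (-1) ^+ r * q ^+ 'C(r, 2) * (1 + q ^+ r).

Section Qseries.
Variables (F : fieldType) (q : F).
(** [q] is not a root of unity, so every [qpoch q n] is invertible. *)
Hypothesis q_neq1 : forall k, 1 - q ^+ k.+1 != 0.

Lemma qbin0 n : qbin q n 0 = 1.
Proof. by case: n. Qed.

Lemma qbin_small n k : (n < k)%N -> qbin q n k = 0.
Proof.
elim: n k => [|n IH] [|k] //= lt_nk.
by rewrite !IH ?mulr0 ?addr0 //; apply: ltnW.
Qed.

Lemma qbinnn n : qbin q n n = 1.
Proof. by elim: n => //= n IH; rewrite qbin_small // add0r subnn mul1r. Qed.

Lemma qpochS n : qpoch q n.+1 = qpoch q n * (1 - q ^+ n.+1).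
Proof. by rewrite /qpoch big_nat_recr. Qed.

Lemma qpoch0 : qpoch q 0 = 1.
Proof. by rewrite /qpoch big_geq. Qed.

Lemma qpoch_neq0 n : qpoch q n != 0.
Proof.
by elim: n => [|n IH]; rewrite ?qpoch0 ?oner_neq0 // qpochS mulf_neq0.
Qed.

(** Induction on both arguments by q-Pascal, since 1 - q^(a+b+2) = (1 - q^(b+1)) + q^(b+1) (1 -
    q^(a+1)). *)
Lemma qbin_qpoch a b : qbin q (a + b) a * (qpoch q a * qpoch q b) = qpoch q (a + b).
Proof.
elim: b a => [|b IHb] a; first by rewrite addn0 qpoch0 mulr1 qbinnn mul1r.
elim: a => [|a IHa]; first by rewrite qbin0 qpoch0 !mul1r.
have -> : qbin q (a.+1 + b.+1) a.+1
        = qbin q (a.+1 + b) a.+1 + q ^+ b.+1 * qbin q (a + b.+1) a.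
  rewrite [(a.+1 + b)%N]addSnnS addSn /=; congr (_ + _ ^+ _ * _); lia.
transitivity ((1 - q ^+ b.+1) * (qbin q (a.+1 + b) a.+1 * (qpoch q a.+1 * qpoch q b))
  + q ^+ b.+1 * (1 - q ^+ a.+1) * (qbin q (a + b.+1) a * (qpoch q a * qpoch q b.+1))).
  by rewrite !qpochS; ring.
by rewrite IHb IHa addSnnS addSn qpochS -addSn exprD; ring.
Qed.

(* q-Chu-Vandermonde in the limiting case where one parameter tends to infinity. *)
Lemma qbin_sum M a :
  \sum_(0 <= t < M.+1) qbin q M t * q ^+ (t * (t + a)) / qpoch q (t + a)
  = (qpoch q (M + a))^-1.
Proof.
elim: M a => [|M IH] a.
  by rewrite big_nat1 /= !mul1r.
rewrite big_nat_recl // qbin0 mul0n !mul1r.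
(* By q-Pascal the sum splits in two: one half, with the term t = 0, is the sum for [M], [a]; the
   other is q^(M+a+1) times the sum for [M], [a + 1]. *)
under eq_bigr => t _ do rewrite /= !mulrDl.
rewrite big_split /= addrA.
have -> : (qpoch q (0 + a))^-1 + \sum_(0 <= t < M.+1)
   qbin q M t.+1 * q ^+ (t.+1 * (t.+1 + a)) / qpoch q (t.+1 + a) = (qpoch q (M + a))^-1.
  rewrite -IH [in RHS]big_nat_recl // qbin0 mul0n !mul1r; congr (_ + _).
  by rewrite big_nat_recr //= qbin_small // !mul0r addr0.
rewrite (_ : \sum_(0 <= t < M.+1) _ = q ^+ (M + a).+1 * (qpoch q (M + a.+1))^-1).
  by rewrite addnS addSn qpochS; field; rewrite qpoch_neq0 q_neq1.
rewrite -IH mulr_sumr [LHS]big_nat [RHS]big_nat; apply: eq_bigr => t /andP[_ lt_tM].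
have E : q ^+ (M - t) * q ^+ (t.+1 * (t.+1 + a)) = q ^+ (M + a).+1 * q ^+ (t * (t + a.+1)).
  by rewrite -!exprD; congr (_ ^+ _); lia.
rewrite [q ^+ _ * qbin _ _ _]mulrC -[X in X / _]mulrA E addnS addSn; ring.
Qed.

(** The preceding sum divided by (q)_M, its Gaussian binomial written as a quotient; this is the
    inner sum in Bailey's lemma. *)
Lemma qpoch_sum M a :
  \sum_(0 <= t < M.+1)
    q ^+ (t * (t + a)) / (qpoch q (M - t) * (qpoch q t * qpoch q (t + a)))
  = (qpoch q M * qpoch q (M + a))^-1.
Proof.
rewrite invfM -qbin_sum mulr_sumr big_nat [RHS]big_nat; apply: eq_bigr => t /andP[_ le_tM].
have := qbin_qpoch t (M - t); rewrite subnKC // => EM.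
have Hb : qbin q M t != 0.
  by apply: contra_neq (qpoch_neq0 M) => Hb; rewrite -EM Hb mul0r.
rewrite -EM; field.
by rewrite Hb !qpoch_neq0.
Qed.

(** * The Bailey chain *)

(** After exchanging the sums and putting s = t + r, the inner sum is [qpoch_sum] with M = N - r and
    a = 2r, because s^2 = r^2 + t (t + 2r). *)
Lemma bailey_lemma (f : nat -> F) N :
  \sum_(0 <= s < N.+1) q ^+ (s * s) / qpoch q (N - s) *
     (\sum_(0 <= r < s.+1) f r / (qpoch q (s - r) * qpoch q (s + r)))
  = \sum_(0 <= r < N.+1) q ^+ (r * r) * f r / (qpoch q (N - r) * qpoch q (N + r)).
Proof.
transitivity (\sum_(0 <= s < N.+1) \sum_(0 <= r < N.+1 | (r <= s)%N)
   q ^+ (s * s) / qpoch q (N - s) * (f r / (qpoch q (s - r) * qpoch q (s + r)))).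
  rewrite big_nat [RHS]big_nat; apply: eq_bigr => s /andP[_ le_sN].
  rewrite mulr_sumr [LHS](big_nat_widen _ _ _ _ _ le_sN).
  by apply: eq_bigl => r; rewrite ltnS.
rewrite (exchange_big_dep_nat xpredT) //= big_nat [RHS]big_nat.
apply: eq_bigr => r /andP[_ le_rN].
transitivity (\sum_(r <= s < N.+1)
   q ^+ (s * s) / qpoch q (N - s) * (f r / (qpoch q (s - r) * qpoch q (s + r)))).
  by rewrite !big_geq_mkord /=; apply: eq_bigl => s; rewrite andbT.
rewrite -{1}[r]add0n big_addn subSn //.
have := qpoch_sum (N - r) (r + r); rewrite addnA subnK // => E.
rewrite -[RHS]mulrA -E !mulr_sumr big_nat [RHS]big_nat.
apply: eq_bigr => t /andP[_ le_t].
rewrite addnK -addnA (_ : (N - (t + r) = N - r - t)%N); last by lia.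
rewrite (_ : ((t + r) * (t + r) = r * r + t * (t + (r + r)))%N); last by lia.
by rewrite exprD; field; rewrite !qpoch_neq0.
Qed.

(* Telescoping: the closed form for [k = s] would carry the factor [1 / (q)_(-1) = 0]. *)
Lemma unit_bailey_partial s k : (k < s)%N ->
  \sum_(0 <= r < k.+1) unit_alpha q r / (qpoch q (s - r) * qpoch q (s + r))
  = (-1) ^+ k * q ^+ 'C(k.+1, 2)
      / (qpoch q (s - k.+1) * qpoch q (s + k) * (1 - q ^+ s)).
Proof.
elim: k => [|k IH] lt_ks.
  rewrite big_nat1 /= subn0 !addn0 subn1 expr0 !mul1r -{1}(prednK lt_ks) qpochS prednK //.
  by rewrite mulrAC.
rewrite big_nat_recr //= IH ?(ltnW lt_ks) // /unit_alpha /=.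
have Ed : (s - k.+1 = (s - k.+2).+1)%N by lia.
have Eq1 : q ^+ s = q ^+ (s - k.+2).+1 * q ^+ k.+1.
  by rewrite -exprD; congr (_ ^+ _); lia.
have Eq2 : q ^+ (s + k).+1 = q ^+ s * q ^+ k.+1.
  by rewrite -exprD addnS.
have EC : 'C(k.+2, 2) = ('C(k.+1, 2) + k.+1)%N by rewrite binS bin1.
have H1 := q_neq1 s.-1; rewrite prednK in H1; last by lia.
have H2 := q_neq1 (s + k); have H3 := q_neq1 (s - k.+2).
rewrite Ed EC addnS !qpochS exprD Eq2.
move: H1 H2 H3; rewrite Eq2 Eq1.
set x := q ^+ (s - k.+2).+1; set y := q ^+ k.+1 => H1 H2 H3.
by rewrite exprS; field; rewrite !qpoch_neq0 H1 H2 H3.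
Qed.

(** For s > 0 the last term cancels the telescoped sum of the others, by 1 - q^(2s) = (1 - q^s)(1 +
    q^s). *)
Lemma unit_bailey s :
  \sum_(0 <= r < s.+1) unit_alpha q r / (qpoch q (s - r) * qpoch q (s + r))
  = (s == 0%N)%:R.
Proof.
case: s => [|s]; first by rewrite big_nat1 qpoch0 mulr1 divr1.
rewrite big_nat_recr //= unit_bailey_partial // /unit_alpha /= !subnn addnS (qpochS (s.+1 + s)) qpoch0.
have Eq : q ^+ (s.+1 + s).+1 = q ^+ s.+1 * q ^+ s.+1 by rewrite -exprD addnS.
have H1 := q_neq1 s; have := q_neq1 (s.+1 + s); rewrite Eq => H2.
by rewrite [(-1) ^+ s.+1]exprS; field; rewrite qpoch_neq0 H1 H2.
Qed.

(* Two steps up the Bailey chain from the unit Bailey pair. *)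
Lemma finite_rogers_ramanujan_frac N :
  \sum_(0 <= s < N.+1) q ^+ (s * s) / (qpoch q (N - s) * qpoch q s)
  = \sum_(0 <= r < N.+1) q ^+ (2 * (r * r)) * unit_alpha q r
        / (qpoch q (N - r) * qpoch q (N + r)).
Proof.
(* First step of the chain: the unit pair leaves only the outer term of index 0. *)
have step1 s : \sum_(0 <= r < s.+1) q ^+ (r * r) * unit_alpha q r
    / (qpoch q (s - r) * qpoch q (s + r)) = (qpoch q s)^-1.
  rewrite -bailey_lemma big_nat_recl // [X in _ + X]big1_seq => [|t _].
    by rewrite unit_bailey addr0 subn0 mulr1 mul1r.
  by rewrite unit_bailey mulr0.
transitivity (\sum_(0 <= s < N.+1) q ^+ (s * s) / qpoch q (N - s)
    * \sum_(0 <= r < s.+1) q ^+ (r * r) * unit_alpha q r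
         / (qpoch q (s - r) * qpoch q (s + r))).
  by apply: eq_bigr => s _; rewrite step1 invfM mulrA.
rewrite bailey_lemma; apply: eq_bigr => r _.
by rewrite mulrA -exprD addnn -mul2n.
Qed.

Lemma qpoch_qprod a b : (a <= b)%N -> qpoch q b = qpoch q a * qprod q a b.
Proof. by move=> le_ab; rewrite /qpoch (big_cat_nat (leq0n a) le_ab). Qed.

(** Multiplying by (q)_N (q)_(2N) clears all denominators. *)
Lemma finite_rogers_ramanujan N :
  \sum_(0 <= s < N.+1) q ^+ (s * s) * (qprod q s N * qprod q (N - s) (N + N))
  = \sum_(0 <= r < N.+1) q ^+ (2 * (r * r)) * unit_alpha q r
       * (qprod q (N - r) N * qprod q (N + r) (N + N)).
Proof.
have qpK a b : (a <= b)%N -> qprod q a b = qpoch q b / qpoch q a.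
  by move=> le_ab; rewrite (qpoch_qprod le_ab) mulrC mulKf ?qpoch_neq0.
have := congr1 ( *%R (qpoch q N * qpoch q (N + N))) (finite_rogers_ramanujan_frac N).
rewrite !mulr_sumr => E; transitivity (\sum_(0 <= i < N.+1)
   qpoch q N * qpoch q (N + N) * (q ^+ (i * i) / (qpoch q (N - i) * qpoch q i))).
  rewrite big_nat [RHS]big_nat; apply: eq_bigr => s /andP[_ le_sN].
  by rewrite !qpK; [field; rewrite !qpoch_neq0 | lia..].
rewrite E big_nat [RHS]big_nat; apply: eq_bigr => s /andP[_ le_sN].
by rewrite !qpK; [field; rewrite !qpoch_neq0 | lia..].
Qed.
End Qseries.

(** * Transfer to polynomials through the field of fractions *)

Lemma tofrac_sub_neq0 (K : fieldType) k : 1 - (tofrac ('X : {poly K})) ^+ k.+1 != 0.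
Proof.
rewrite -tofracXn -tofrac1 -tofracB tofrac_eq0.
apply/eqP => /(congr1 (fun p : {poly K} => p`_0)) /eqP.
by rewrite coefB coefXn coef1 coef0 subr0 oner_eq0.
Qed.

Lemma rmorph_qprod (R S : comNzRingType) (f : {rmorphism R -> S}) x a b :
  f (qprod x a b) = qprod (f x) a b.
Proof.
by rewrite rmorph_prod; apply: eq_bigr => i _; rewrite rmorphB rmorph1 rmorphXn.
Qed.

Lemma rmorph_unit_alpha (R S : comNzRingType) (f : {rmorphism R -> S}) x r :
  f (unit_alpha x r) = unit_alpha (f x) r.
Proof.
rewrite /unit_alpha; case: ifP => _; first by rewrite rmorph1.
by rewrite !rmorphM rmorphD rmorph_sign rmorph1 !rmorphXn.
Qed.

Lemma finite_rogers_ramanujan_poly (K : fieldType) N :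
  \sum_(0 <= s < N.+1) 'X ^+ (s * s) * (qprod 'X s N * qprod 'X (N - s) (N + N))
  = \sum_(0 <= r < N.+1) 'X ^+ (2 * (r * r)) * unit_alpha 'X r
       * (qprod 'X (N - r) N * qprod 'X (N + r) (N + N)) :> {poly K}.
Proof.
apply/eqP; rewrite -subr_eq0 -tofrac_eq0 tofracB subr_eq0; apply/eqP.
have := finite_rogers_ramanujan (@tofrac_sub_neq0 K) N.
rewrite !rmorph_sum /= => E.
under eq_bigr => s _ do rewrite !rmorphM rmorphXn !rmorph_qprod /=.
under [RHS]eq_bigr => s _ do rewrite !rmorphM rmorphXn !rmorph_qprod rmorph_unit_alpha /=.
exact: E.
Qed.

(** * Congruences modulo powers of X *)

Definition eq_upto (R : nzRingType) (n : nat) (p p' : {poly R}) :=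
  exists g, p = p' + 'X^n * g.

Lemma eq_upto_coef (R : nzRingType) n (p p' : {poly R}) i :
  eq_upto n p p' -> (i < n)%N -> p`_i = p'`_i.
Proof. by case=> g -> lt_in; rewrite coefD coefXnM lt_in addr0. Qed.

Lemma eq_upto_sum (R : nzRingType) n (I : eqType) (r : seq I) (f g : I -> {poly R}) :
  (forall i, i \in r -> eq_upto n (f i) (g i)) ->
  eq_upto n (\sum_(i <- r) f i) (\sum_(i <- r) g i).
Proof.
elim: r => [|i r IH] H; first by exists 0; rewrite !big_nil mulr0 addr0.
have [h Eh] := H i (mem_head _ _).
have [|h' Eh'] := IH => [j jr|]; first by apply: H; rewrite inE jr orbT.
by exists (h + h'); rewrite !big_cons Eh Eh' mulrDr addrACA.
Qed.

Lemma eq_upto_qprod (K : fieldType) a b : eq_upto a.+1 (qprod 'X a b) (1 : {poly K}).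
Proof.
elim: b => [|b [g IH]]; first by exists 0; rewrite /qprod big_geq // mulr0 addr0.
have [le_ab|lt_ba] := leqP a b; last first.
  by exists 0; rewrite /qprod big_geq // mulr0 addr0.
rewrite /qprod big_nat_recr //= -/(qprod _ _ _) IH.
rewrite (_ : b.+1 = a.+1 + (b - a))%N; last by lia.
exists (g - 'X^(b - a) - 'X^(a.+1 + (b - a)) * g); rewrite exprD; ring.
Qed.

Lemma eq_upto_mulr1 (R : comNzRingType) n k a (c e : {poly R}) :
  eq_upto a e 1 -> (n <= k + a)%N -> eq_upto n ('X^k * c * e) ('X^k * c).
Proof.
case=> g -> le_n; exists ('X^(k + a - n) * c * g).
rewrite [X in _ = _ + X]mulrA [X in _ = _ + X * g]mulrA -exprD subnKC // exprD; ring.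
Qed.

Lemma eq_upto_trans (R : nzRingType) n (p2 p1 p3 : {poly R}) :
  eq_upto n p1 p2 -> eq_upto n p2 p3 -> eq_upto n p1 p3.
Proof. by move=> [g ->] [h ->]; exists (h + g); rewrite mulrDr addrA. Qed.

Lemma eq_upto_sym (R : nzRingType) n (p1 p2 : {poly R}) :
  eq_upto n p1 p2 -> eq_upto n p2 p1.
Proof. by move=> [g ->]; exists (- g); rewrite mulrN addrK. Qed.

(** At index i each dropped product is 1 modulo X^(N-i+1), and the factor X^(i^2) or X^(2 i^2)
    raises the order of the error to at least N + 1. *)
Lemma rogers_ramanujan_upto (K : fieldType) N :
  eq_upto N.+1 (\sum_(0 <= s < N.+1) 'X^(s * s) * qprod 'X s N)
    (\sum_(0 <= r < N.+1) 'X^(2 * (r * r)) * unit_alpha 'X r : {poly K}).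
Proof.
apply: (eq_upto_trans (p2 := \sum_(0 <= s < N.+1)
   'X^(s * s) * (qprod 'X s N * qprod 'X (N - s) (N + N)))).
  apply: eq_upto_sum => s; rewrite mem_index_iota => /andP[_ le_sN].
  apply: eq_upto_sym; rewrite mulrA.
  by apply: eq_upto_mulr1; [exact: eq_upto_qprod | nia].
rewrite finite_rogers_ramanujan_poly.
apply: eq_upto_sum => r; rewrite mem_index_iota => /andP[_ le_rN].
rewrite mulrA; apply: (eq_upto_trans (p2 := 'X^(2 * (r * r)) * unit_alpha 'X r * qprod 'X (N - r) N)).
  by rewrite -(mulrA 'X^_); apply: eq_upto_mulr1; [exact: eq_upto_qprod | nia].
by apply: eq_upto_mulr1; [exact: eq_upto_qprod | nia].
Qed.

(** * Generating functions of the two kinds of partitions *)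

(** Condition (a) is the case k = 0, l = 1; condition (b) for a given j is k = j^2, l = j. *)
Definition shape (n k l : nat) (m : {ffun 'I_n.+1 -> 'I_n.+1}) : bool :=
  [forall i : 'I_n.+1,
     if i == 1%N :> nat then m i == k :> nat
     else (0 < m i)%N ==> ((l.+1 <= i)%N && (m i <= 1)%N)].

Definition mult_ok (k l i j : nat) : bool :=
  if i == 0%N then j == 0%N else if i == 1%N then j == k
  else (0 < j)%N ==> ((l.+1 <= i)%N && (j <= 1)%N).

Lemma is_partition_shape n k l (m : {ffun 'I_n.+1 -> 'I_n.+1}) :
  is_partition m && shape k l m =
  [forall i : 'I_n.+1, mult_ok k l i (m i)] && (\sum_(i < n.+1) i * m i == n)%N.
Proof.
rewrite /is_partition -andbA andbCA [RHS]andbC; congr (_ && _).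
apply/andP/forallP => [[/eqP m0 /forallP H] i | H].
  rewrite /mult_ok; case: (eqVneq (i : nat) 0%N) => [i0 | i0].
    by rewrite (_ : i = ord0) ?m0 //; apply: val_inj.
  exact: H.
have m0 : m ord0 == 0%N :> nat := H ord0.
split=> //; apply/forallP => i; have := H i; rewrite /mult_ok.
case: (eqVneq (i : nat) 0%N) => [i0 /eqP -> | //].
by rewrite i0.
Qed.

(** Expanding a product over parts of sums over multiplicities gives one monomial per admissible
    [m], with exponent the sum of the parts. *)
Lemma count_shape (R : comNzRingType) n k l : (0 < n)%N -> (0 < l)%N ->
  (#|[set m : {ffun 'I_n.+1 -> 'I_n.+1} | is_partition m && shape k l m]|)%:R
  = ('X^k * \prod_(l <= i < n) (1 + 'X ^+ i.+1) : {poly R})`_n.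
Proof.
move=> n_gt0 l_gt0.
pose F (i j : nat) : {poly R} := if mult_ok k l i j then 'X^(i * j) else 0.
transitivity ((\prod_(i < n.+1) \sum_(j < n.+1) F i j)`_n).
  rewrite bigA_distr_bigA coef_sum cardsE -sum1_card natr_sum big_mkcond /=.
  apply: eq_bigr => m _; rewrite unfold_in /= is_partition_shape.
  case: (boolP [forall i, _]) => [/forallP H | ] /=.
    rewrite (eq_bigr (fun i : 'I_n.+1 => 'X^(i * m i))) => [|i _]; last by rewrite /F H.
    by rewrite -expr_sum coefXn eq_sym; case: ifP.
  rewrite negb_forall => /existsP[i /negbTE Hi].
  by rewrite (bigD1 i) //= {1}/F Hi mul0r coef0.
case: n n_gt0 => // p _.
(* If [k] exceeds the size of the partition, both sides are 0. *)
have [le_kp | lt_pk] := leqP k p.+1; last first.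
  rewrite coefXnM lt_pk 2!big_ord_recl /= [X in _ * (X * _)]big1 => [|j _].
    by rewrite mul0r mulr0 coef0.
  by rewrite /F /mult_ok /= ltn_eqF // (leq_trans (ltn_ord j)).
rewrite 2!big_ord_recl /= [X in X * _]big_ord_recl big1 /= => [|j _]; last first.
  by rewrite /F /mult_ok.
rewrite /F /mult_ok /= mul0n expr0 addr0 mul1r.
rewrite (bigD1 (Ordinal (le_kp : (k < p.+2)%N))) //= eqxx mul1n big1 => [|j Hj]; last first.
  by rewrite ifF //; apply: contraNF Hj => /eqP jk; apply/eqP/val_inj.
rewrite addr0; congr (('X^k * _)`_ _).
(* The factor of index i belongs to the part i + 1, so l > 0 keeps the part 1 out of the product. *)
rewrite [RHS]big_geq_mkord /= [RHS]big_mkcond /= [RHS]big_ord_recl /= leqNgt l_gt0 /= mul1r.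
apply: eq_bigr => i _.
rewrite 2!big_ord_recl /= big1 => [|j _]; last first.
  by rewrite andbF.
rewrite /bump /= !add1n muln0 muln1 andbT addr0 ltnS.
by case: ifP => _; rewrite ?addr0.
Qed.

Lemma sum_bool_unique (I : finType) (P Q : pred I) :
  (forall i j, P i -> Q i -> P j -> Q j -> i = j) ->
  (\sum_(i | P i) (Q i : nat) = [exists i, P i && Q i] :> nat)%N.
Proof.
move=> uniqPQ; case: (boolP [exists i, _]) => [/existsP[i /andP[Pi Qi]] | ].
  rewrite (bigD1 i) //= Qi big1 // => j /andP[Pj]; case: (boolP (Q j)) => // Qj.
  by rewrite (uniqPQ j i) // eqxx.
rewrite negb_exists => /forallP H; rewrite big1 // => i Pi.
by have := H i; rewrite Pi /= => /negbTE ->.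
Qed.

Lemma shape_mult1 n k l (m : {ffun 'I_n.+2 -> 'I_n.+2}) :
  shape k l m -> m (Ordinal (isT : 1 < n.+2)%N) = k :> nat.
Proof. by move=> /forallP /(_ (Ordinal (isT : 1 < n.+2)%N)) /= /eqP. Qed.

(** The cases are disjoint, as the number of ones, 0 or j^2 with j >= 2, tells them apart. *)
Lemma c9_shapes n : (0 < n)%N ->
  c9 n = (#|[set m : {ffun 'I_n.+1 -> 'I_n.+1} | is_partition m && shape 0 1 m]|
    + \sum_(j < n.+1 | (2 <= j)%N)
        #|[set m : {ffun 'I_n.+1 -> 'I_n.+1} | is_partition m && shape (j ^ 2) j m]|)%N.
Proof.
case: n => // n _.
have cardE (P : pred {ffun 'I_n.+2 -> 'I_n.+2}) : #|[set m | P m]| = (\sum_m (P m : nat))%N.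
  by rewrite cardsE -sum1_card big_mkcond.
rewrite /c9 !cardE.
under [X in (_ + X)%N]eq_bigr => j _ do rewrite cardE.
rewrite exchange_big /= -big_split /=; apply: eq_bigr => m _.
case: (boolP (is_partition m)) => [/andP[/eqP m0 _] | _] /=; last by rewrite big1.
have -> : cond_a m = shape 0 1 m.
  apply/forallP/forallP => H i; have := H i.
    case: (eqVneq (i : nat) 1%N) => [_ /= /andP[_ ->] // | i1].
    case: (eqVneq (i : nat) 0%N) => [i0 | i0 /andP[-> _]]; last by lia.
    by rewrite (_ : i = ord0) ?m0 //; apply: val_inj.
  by case: (eqVneq (i : nat) 1%N) => [_ /eqP -> // | i1]; lia.
have -> : cond_b m = [exists j : 'I_n.+2, (2 <= j)%N && shape (j ^ 2) j m] by [].
rewrite sum_bool_unique => [|i j _ Hi _ Hj]; last first.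
  by apply/val_inj/eqP; rewrite -eqn_sqr -(shape_mult1 Hi) -(shape_mult1 Hj).
case: (boolP (shape 0 1 m)) => //= H; case: existsP => // -[j /andP[j2 Hj]].
by have := shape_mult1 H; rewrite (shape_mult1 Hj) => /eqP; rewrite expn_eq0; lia.
Qed.

(** * Reduction modulo 2 *)

Lemma natr_F2_odd (m m' : nat) : m%:R = m'%:R :> 'F_2 -> odd m = odd m'.
Proof.
move=> /(congr1 val); rewrite /= !val_Fp_nat // !modn2.
by case: (odd m) (odd m') => [] [].
Qed.

Lemma oppr_polyF2 (p : {poly 'F_2}) : - p = p.
Proof. by apply/polyP => i; rewrite coefN oppr_pchar2 ?pchar_Fp. Qed.

Lemma c9_coef n : (0 < n)%N ->
  (c9 n)%:R = (\sum_(0 <= s < n.+1) 'X^(s * s) * qprod 'X s n : {poly 'F_2})`_n.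
Proof.
move=> n_gt0.
have qprodE s : qprod 'X s n = \prod_(s <= i < n) (1 + 'X ^+ i.+1) :> {poly 'F_2}.
  by apply: eq_bigr => i _; rewrite oppr_polyF2.
rewrite (c9_shapes n_gt0) natrD natr_sum count_shape // -qprodE mul1r.
under eq_bigr => j j2 do rewrite count_shape ?(ltnW j2) // -qprodE.
rewrite big_ltn // big_ltn ?ltnS // !mul1r.
(* The terms s = 0 and s = 1 add up to (1 - X) P + X P = P with P = [qprod 'X 1 n], which counts
   condition (a). *)
rewrite [qprod 'X 0 n](_ : _ = (1 - 'X) * qprod 'X 1 n); last by rewrite /qprod big_ltn.
rewrite addrA -mulrDl subrK mul1r coefD; congr (_ + _).
rewrite coef_sum big_geq_mkord /=; apply: eq_bigr => j _.
by rewrite mulnn.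
Qed.

(** * The exponents (5j^2 + j)/2 *)

(* The number of [j = r] or [-r] with [n = (5 j^2 + j) / 2]. *)
Definition pent_count (n r : nat) : nat :=
  if r == 0%N then (n == 0%N : nat)
  else ((n == 2 * (r * r) + 'C(r, 2)) + (n == 2 * (r * r) + 'C(r, 2) + r))%N.

Lemma unit_alpha_coef n r :
  ('X^(2 * (r * r)) * unit_alpha 'X r : {poly 'F_2})`_n = (pent_count n r)%:R.
Proof.
rewrite /unit_alpha /pent_count; case: (eqVneq r 0%N) => [-> | _].
  by rewrite mulr1 coefXn.
rewrite oppr_polyF2 expr1n mul1r mulrA -exprD mulrDr mulr1 -exprD coefD !coefXn.
by rewrite natrD.
Qed.

(** Identifies 2r^2 + C(r,2) and 2r^2 + C(r,2) + r with (5r^2 - r)/2 and (5r^2 + r)/2. *)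
Lemma double_bin2 r : (2 * 'C(r, 2) + r = r * r)%N.
Proof. by elim: r => // r IH; rewrite binS bin1; lia. Qed.

(** The values (5j^2 + j)/2 are distinct for distinct integers j, so the sum is 0 or 1. *)
Lemma odd_pent_sum n :
  odd (\sum_(0 <= r < n.+1) pent_count n r)%N
  <-> exists r : nat, (2 * n = 5 * (r * r) + r \/ 2 * n + r = 5 * (r * r))%N.
Proof.
have pentP r : (0 < pent_count n r)%N ->
    (2 * n = 5 * (r * r) + r \/ 2 * n + r = 5 * (r * r))%N.
  rewrite /pent_count; have := double_bin2 r; case: eqP => [-> | _]; last by lia.
  by case: eqP; lia.
split=> [|[r0 H0]].
  case: (boolP [exists r : 'I_n.+1, (0 < pent_count n r)%N]) => [/existsP[r /pentP] | ].
    by exists r.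
  rewrite negb_exists => /forallP H; rewrite big_mkord big1 // => r _.
  by have := H r; lia.
have le_r0 : (r0 < n.+1)%N by nia.
rewrite big_mkord (bigD1 (Ordinal le_r0)) //= big1 => [|r /eqP nr]; last first.
  case: (posnP (pent_count n r)) => // /pentP H; case: nr; apply: val_inj => /=.
  by case: (ltngtP (r : nat) r0) => // lt_r; nia.
rewrite /pent_count addn0; have := double_bin2 r0; case: (eqVneq r0 0%N) => [r00 | nz] E.
  by rewrite (_ : n = 0)%N //; lia.
have n_r0 : (n == 2 * (r0 * r0) + 'C(r0, 2))%N != (n == 2 * (r0 * r0) + 'C(r0, 2) + r0)%N by lia.
by rewrite oddD !oddb addbC -negb_eqb eq_sym.
Qed.

(** Treated apart because the index 1 is out of range when n = 0; only the empty partition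
    occurs. *)
Lemma odd_c9_0 : odd (c9 0).
Proof.
rewrite /c9 (_ : [set _ | _] = setT) ?cardsT ?card_ffun ?card_ord //.
apply/setP => m; have m0 i : m i = ord0 by apply: ord1.
rewrite !inE /is_partition big_ord1 m0 /= /cond_a.
by apply/orP; left; apply/forallP => i; rewrite m0 /= implybT.
Qed.

(* c9 n is odd iff n = (5 j^2 + j)/2 for some integer j; even otherwise. *)
Theorem theorem10 (n : nat) :
  odd (c9 n) <-> exists j : int, (2 * (n%:Z) = 5 * j ^+ 2 + j)%R.
Proof.
have -> : odd (c9 n) = odd (\sum_(0 <= r < n.+1) pent_count n r)%N.
  case: (posnP n) => [-> | n_gt0]; first by rewrite big_nat1 odd_c9_0.
  apply: natr_F2_odd; rewrite c9_coef //.
  rewrite (eq_upto_coef (rogers_ramanujan_upto _ n) (ltnSn n)) coef_sum natr_sum.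
  by apply: eq_bigr => r _; rewrite unit_alpha_coef.
rewrite odd_pent_sum; split=> [[r [] H] | [j Hj]].
- by exists r%:Z; nia.
- by exists (- r%:Z); nia.
- by exists `|j|%N; case: (intP j) Hj => [|k|k] Hj; [left | left | right]; nia.
Qed.
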